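(* Let $A$ be a commutative ring with identity and $HA$ the ring of Hurwitz series over $A$. Let $n\in\mathbb{N}^+$ be fixed and let $z_0,z_1,\dots,z_{n-1}\in HA$. For every $k\in\mathbb{N}$ write $\widehat{k}=\lfloor k/n\rfloor$ and $\overline{k}=k-\widehat{k}n$. Then for all $k\in\mathbb{N}$, $$\langle k\rangle\cdot \mathrm{intl}(z_0,\dots,z_{n-1})=\mathrm{intl}\Big(\int^{\widehat{k}+1}C^{n-\overline{k}+k}_{k,n}\boxdot z_{n-\overline{k}},\ \dots,\ \int^{\widehat{k}+1}C^{n-1+k}_{k,n}\boxdot z_{n-1},\ \int^{\widehat{k}}C^{k}_{k,n}\boxdot z_0,\ \dots,\ \int^{\widehat{k}}C^{n-\overline{k}-1+k}_{k,n}\boxdot z_{n-\overline{k}-1}\Big),$$ i.e. the $j$-th argument ($0\le j\le n-1$) of the interlacing on the right is $\int^{\widehat{k}+1}C^{n-\overline{k}+j+k}_{k,n}\boxdot z_{n-\overline{k}+j}$ if $j<\overline{k}$ and $\int^{\widehat{k}}C^{j-\overline{k}+k}_{k,n}\boxdot z_{j-\overline{k}}$ if $j\ge\overline{k}$.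
   Context: $HA$ is the set of sequences $f=(f(0),f(1),\dots)$ with entries in $A$, with componentwise addition and product $(fg)(m)=\sum_{i=0}^m\binom{m}{i}f(i)g(m-i)$. The integral is $\int f=(0,f(0),f(1),\dots)$ and $\int^m$ denotes its $m$-fold iterate ($\int^0=\mathrm{id}$). For $m\in\mathbb{N}$, $\langle m\rangle\in HA$ is the sequence with $\langle m\rangle(i)=\delta_{i,m}$. For fixed $n\in\mathbb{N}^+$ and $m\in\mathbb{N}$, $\widehat{m}=\lfloor m/n\rfloor$, $\overline{m}=m-\widehat{m}n$. The interlacing of $z_0,\dots,z_{n-1}\in HA$ is the element $\mathrm{intl}(z_0,\dots,z_{n-1})\in HA$ given by $\mathrm{intl}(z_0,\dots,z_{n-1})(m)=z_{\overline{m}}(\widehat{m})$, i.e. $(z_0(0),\dots,z_{n-1}(0),z_0(1),\dots,z_{n-1}(1),\dots)$. The Hadamard product is $(f\boxdot g)(p)=f(p)g(p)$. For $\ell,k\in\mathbb{N}$, $C^{\ell}_{k,n}\in HA$ is defined by $C^{\ell}_{k,n}(p)=\binom{\ell+pn}{k}$ for all $p\in\mathbb{N}$ (with $\binom{a}{b}=0$ if $a<b$). *)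

(* Defs.v *)
From HB Require Import structures.
From mathcomp Require Import all_boot all_algebra.

Set Implicit Arguments.
Unset Strict Implicit.
Unset Printing Implicit Defensive.

Import GRing.Theory.
Local Open Scope ring_scope.

(* The zero ring is allowed: A ranges over comPzRingType. *)
Definition hurwitz (A : comPzRingType) : Type := nat -> A.

Section Hurwitz.
Variable A : comPzRingType.
Implicit Types f g : hurwitz A.

Definition hzero : hurwitz A := fun _ => 0.

Definition hmul f g : hurwitz A :=
  fun m => \sum_(i < m.+1) 'C(m, i)%:R * f i * g (m - i)%N.

Definition hint f : hurwitz A := fun m => if m is p.+1 then f p else 0.

Definition hdelta (m : nat) : hurwitz A := fun i => (i == m)%:R.

Definition hadamard f g : hurwitz A := fun p => f p * g p.

Definition hbinom (n l k : nat) : hurwitz A := fun p => 'C(l + p * n, k)%:R.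

(* For 0 < n the index m %% n is always in range, so the default hzero of nth
   is never returned. *)
Definition intl (n : nat) (z : n.-tuple (hurwitz A)) : hurwitz A :=
  fun m => nth hzero z (m %% n)%N (m %/ n)%N.

End Hurwitz.

Arguments hzero {A}.
Arguments hdelta {A} m.
Arguments hbinom {A} n l k.

(* Main.v *)
(* Multiplying by <k> shifts by k and weights entry m with C(m, k). Writing
   m = q n + j, the shifted index m - k equals (q - r) n + l, where l < n and
   l + k = j + r n: the shift permutes the interlaced sequences cyclically and
   integrates each of them r times, with r = khat + 1 or r = khat according to
   whether j < kbar or not. *)
Require Import Defs.
From HB Require Import structures.
From mathcomp Require Import all_boot all_algebra.
From mathcomp Require Import zify.
From Stdlib Require Import FunctionalExtensionality.

Import GRing.Theory.

Local Open Scope ring_scope.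

(** For [m < k] the truncated [m - k] is 0, but the vanishing binomial kills the spurious value
    [f 0]. *)
Lemma hmul_hdelta (A : comPzRingType) (k : nat) (f : hurwitz A) (m : nat) :
  hmul (hdelta k) f m = 'C(m, k)%:R * f (m - k)%N.
Proof.
rewrite /hmul /hdelta; have [lt_mk|le_km] := ltnP m k.
  rewrite bin_small // mul0r big1 // => i _.
  by rewrite ltn_eqF ?mulr0 ?mul0r // (leq_ltn_trans _ lt_mk) // -ltnS.
rewrite (bigD1 (Ordinal (le_km : (k < m.+1)%N))) //= eqxx mulr1.
rewrite big1 ?addr0 // => i /negPf; rewrite -val_eqE /= => ->.
by rewrite mulr0 mul0r.
Qed.

Lemma iter_hint (A : comPzRingType) (r : nat) (f : hurwitz A) (p : nat) :
  iter r (@hint A) f p = if (r <= p)%N then f (p - r)%N else 0.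
Proof. by elim: r p => [|r IHr] [|p] //=; rewrite ?subn0 // IHr subSS. Qed.

(** Keeping [r] and [l] abstract lets both branches of the theorem be instances of one
    computation. *)
Lemma hmul_hdelta_intl (A : comPzRingType) (n : nat)
    (z : n.-tuple (hurwitz A)) (k m r l : nat) :
  (l < n)%N -> (l + k = m %% n + r * n)%N ->
  hmul (hdelta k) (intl z) m =
  iter r (@hint A) (hadamard (hbinom n (l + k) k) (nth hzero z l)) (m %/ n)%N.
Proof.
move=> lt_ln def_l; rewrite hmul_hdelta iter_hint.
have def_m := divn_eq m n; have [le_rq|lt_qr] := leqP r (m %/ n)%N.
  have def_mk : (m - k = (m %/ n - r) * n + l)%N by nia.
  rewrite /hadamard /hbinom /intl def_mk.
  rewrite modnMDl modn_small // divnMDl ?(leq_ltn_trans _ lt_ln) //.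
  rewrite (divn_small lt_ln) addn0.
  by congr ('C(_, k)%:R * _); nia.
(* Since [l < n], [m %/ n < r] forces [m < k]: the leading zeros of the iterated integral are the
   zeros of the binomial. *)
by rewrite bin_small ?mul0r //; nia.
Qed.

Theorem theorem3p10 (A : comPzRingType) (n : nat) (n_gt0 : (0 < n)%N)
    (z : n.-tuple (hurwitz A)) (k : nat) :
  let khat := (k %/ n)%N in
  let kbar := (k - khat * n)%N in
  hmul (hdelta k) (intl z) =
  intl [tuple
    if (j < kbar)%N then
      iter khat.+1 (@hint A)
        (hadamard (hbinom n (n - kbar + j + k) k) (nth hzero z (n - kbar + j)))
    else
      iter khat (@hint A)
        (hadamard (hbinom n (j - kbar + k) k) (nth hzero z (j - kbar)))
    | j < n].
Proof.
move=> khat kbar; apply: functional_extensionality => m.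
have lt_jn : (m %% n < n)%N by rewrite ltn_mod.
have def_kbar : kbar = (k %% n)%N by rewrite /kbar {1}(divn_eq k n) addKn.
have lt_kbar : (kbar < n)%N by rewrite def_kbar ltn_mod.
have def_k : (khat * n + kbar = k)%N by rewrite def_kbar -divn_eq.
rewrite {2}/intl (nth_map (Ordinal lt_jn)) ?size_enum_ord //.
rewrite nth_enum_ord //=.
case: ltnP => [lt_j|le_j].
  (* Wrapping around costs one extra integral: with [j = m %% n],
     [(n - kbar + j) + k = j + khat.+1 * n]. *)
  by apply: (@hmul_hdelta_intl _ _ _ _ _ khat.+1); rewrite ?mulSn; lia.
by apply: hmul_hdelta_intl; lia.
Qed.
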